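(* Let $\delta\ge0$, $d_1,d_2\in\mathbb{Z}$, and let $\mathcal{L}=\mathcal{O}(-d_1,-d_2)$ be an invertible sheaf on the Hirzebruch surface $S_\delta$ such that there exists a foliation $\mathcal{F}\in\mathrm{Fol}(\mathcal{L},S_\delta)$ with isolated singularities. If $\delta=0$, then either $\mathcal{L}\cong\mathcal{O}(-\delta,2)=\mathcal{O}(0,2)$, or $\mathcal{L}\cong\mathcal{O}(2,0)$, or $d_1\ge0$ and $d_2\ge0$. If $\delta\ge1$, then either $\mathcal{L}\cong\mathcal{O}(-\delta,2)$, or $d_1\ge-1$ and $d_2\ge0$.
   Context: Everything is over $\mathbb{C}$. For an integer $\delta\ge 0$, the Hirzebruch surface $S_\delta=\mathbb{P}(\mathcal{O}_{\mathbb{P}^1}\oplus\mathcal{O}_{\mathbb{P}^1}(-\delta))$ is a $\mathbb{P}^1$-bundle over $\mathbb{P}^1$. Its divisor class group is free on $F,M$ with $F$ the class of a fibre, $F^2=0$, $M^2=\delta$, $F\cdot M=1$ (for $\delta>0$, $M-\delta F$ is the class of the unique irreducible curve of negative self-intersection); $\mathcal{O}(d_1,d_2)$ is the invertible sheaf of class $d_1F+d_2M$. $\Theta_{S_\delta}$ is the tangent sheaf. A foliation with tangent sheaf $\mathcal{L}$ is a class $[s]$, up to nonzero scalars, of a nonzero section $s\in H^0(S_\delta,\Theta_{S_\delta}\otimes\mathcal{L}^* )$; the space of these is $\mathrm{Fol}(\mathcal{L},S_\delta)=\mathbb{P}H^0(S_\delta,\Theta_{S_\delta}\otimes\mathcal{L}^*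 )$. The singular scheme $Z_s$ of $[s]$ is the closed subscheme whose ideal sheaf is locally generated by the two coefficients of a local vector field defining $s$. The foliation $[s]$ has isolated singularities if $\dim Z_s=0$, where the case $Z_s=\emptyset$ is also allowed. The sheaves $\mathcal{O}(-\delta,2)$ and $\mathcal{O}(2,0)$ are those denoted $\mathcal{O}(\tau)$ and $\mathcal{O}(N)$ in the paper: the relative tangent sheaf of the ruling $S_\delta\to\mathbb{P}^1$ and the normal sheaf to the ruling. *)

(* Defs.v *)
From mathcomp Require Import all_boot all_order all_algebra.
From mathcomp Require Import boolp classical_sets reals.
From mathcomp Require Export complex.

Set Implicit Arguments.
Unset Strict Implicit.
Unset Printing Implicit Defensive.

Import Order.TTheory GRing.Theory Num.Theory.
Local Open Scope classical_set_scope.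
Local Open Scope ring_scope.

(** The Hirzebruch surface is treated as an integral separated scheme over [k]
    given by its standard cover by four affine planes [Spec A_i], where the
    rings [A_i] are subrings of the function field [k(x, y)].  A torsion-free
    sheaf is a subsheaf of the constant sheaf given by its generic stalk, and
    its global sections are the elements of the generic stalk that are sections
    over each of the four charts. *)

Section Hirzebruch.
Variables (k : fieldType) (delta : nat).

(** Following [polyXY], ['X] is the outer variable of [{poly {poly k}}] and
    ['Y] the inner one. *)
Local Notation B := {poly {poly k}}.

Definition fun_field := {fraction B}.
Local Notation K := fun_field.

Definition const_fun (c : k) : K := tofrac (c%:P%:P : B).
Definition x_fun : K := tofrac ('X : B).
Definition y_fun : K := tofrac ('Y : B).

(** The chart [(a, b)]: [a] selects the chart of the base P^1 (coordinate [x]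
    or [1 / x]) and [b] the chart of the fibre.  The ratio of the two summands
    of O + O(-delta) is [y] over the first chart of the base and
    [x ^ delta * y] over the second one. *)
Definition chart : Type := bool * bool.

Definition base_coord (i : chart) : K := if i.1 then x_fun^-1 else x_fun.

Definition fibre_coord (i : chart) : K :=
  let t := if i.1 then x_fun ^+ delta * y_fun else y_fun in
  if i.2 then t^-1 else t.

Definition chart_eval (i : chart) (p : B) : K :=
  (map_poly (map_poly const_fun) p).[base_coord i, fibre_coord i].

Definition chart_ring (i : chart) : set K := range (chart_eval i).

(** An invertible sheaf is given by a local generator over each chart: the
    sheaf [L] is the subsheaf of the constant sheaf [K] whose sections over
    [U_i] are [A_i * L i]. *)
Definition inv_sheaf : Type := chart -> K.

Definition inv_sheaf_sections (L : inv_sheaf) (i : chart) : set K :=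
  [set a * L i | a in chart_ring i].

(** Every isomorphism between such subsheaves is the multiplication by a
    nonzero rational function. *)
Definition inv_sheaf_iso (L L' : inv_sheaf) : Prop :=
  exists2 f : K, f != 0 &
    forall i z, inv_sheaf_sections L i z <-> inv_sheaf_sections L' i (f * z).

Definition dual_sheaf (L : inv_sheaf) : inv_sheaf := fun i => (L i)^-1.

(** O(d1, d2) = O(d1 F + d2 M), where F is represented by the fibre
    [x = infinity] and M by the section [y = infinity].  The latter is disjoint
    from the section E : [y = 0], and [div y = E - M + delta F], so that
    M^2 = delta and E = M - delta F has self-intersection - delta. *)
Definition O_sheaf (d1 d2 : int) : inv_sheaf := fun i =>
  (if i.1 then base_coord i ^ (- d1) else 1) *
  (if i.2 then fibre_coord i ^ (- d2) else 1).

Definition is_derivation (v : K -> K) : Prop :=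
  [/\ forall f g, v (f + g) = v f + v g,
      forall f g, v (f * g) = v f * g + f * v g
    & forall c, v (const_fun c) = 0].

(** Sections over [U_i] of the tangent sheaf: the k-derivations of [A_i],
    extended to [K]. *)
Definition tangent_sections (i : chart) : set (K -> K) :=
  [set v | is_derivation v /\
           forall f, chart_ring i f -> chart_ring i (v f)].

Definition twisted_tangent_sections (M : inv_sheaf) (i : chart) :
    set (K -> K) :=
  [set (fun f => M i * v f) | v in tangent_sections i].

Definition H0_twisted_tangent (M : inv_sheaf) : set (K -> K) :=
  [set s | forall i, twisted_tangent_sections M i s].

Definition proj_class (s : K -> K) : set (K -> K) :=
  [set t | exists2 c : k, c != 0 & t = fun f => const_fun c * s f].

Definition Fol (L : inv_sheaf) : set (set (K -> K)) :=
  [set F | exists s, [/\ H0_twisted_tangent (dual_sheaf L) s,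
                         s <> (fun=> 0) & F = proj_class s]].

(** The ideal of [Z_s] on [U_i] = Spec k[X, Y]: it is generated by the
    coefficients of the local vector field [L i * s] in the basis dual to the
    differentials of the two coordinates. *)
Definition singular_ideal (L : inv_sheaf) (s : K -> K) (i : chart) : set B :=
  [set p | exists q r : B,
     chart_eval i p = chart_eval i q * (L i * s (base_coord i)) +
                      chart_eval i r * (L i * s (fibre_coord i))].

Definition is_prime_ideal (P : {pred B}) : Prop :=
  idealr_closed P /\ prime_idealr_closed P.

(** The quotient of [B] by [J] is zero or has Krull dimension 0: there is no
    strict inclusion between two prime ideals containing [J]. *)
Definition dim_le0 (J : set B) : Prop :=
  forall P Q : {pred B}, is_prime_ideal P -> is_prime_ideal Q ->
    (forall p, J p -> p \in P) -> {subset P <= Q} -> {subset Q <= P}.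

Definition isolated_singularities (L : inv_sheaf) (F : set (K -> K)) : Prop :=
  forall s, F s -> forall i, dim_le0 (singular_ideal L s i).

End Hirzebruch.

(* Main.v *)
Require Import Defs.
From HB Require Import structures.
From mathcomp Require Import all_boot all_order all_algebra.
From mathcomp Require Import generic_quotient.
From mathcomp Require Import boolp.
From mathcomp Require Import reals.
From mathcomp Require Import complex.
From mathcomp Require Import ring zify.
Set Implicit Arguments.
Unset Strict Implicit.
Unset Printing Implicit Defensive.
Import Order.TTheory GRing.Theory Num.Theory.
Import Pdiv.Idomain.
Local Open Scope ring_scope.

(** Why the theorem holds.  A section [s] is a derivation of [k(x, y)],
    [s = A d/dx + B d/dy].  Over each chart it is described by two polynomials,
    and comparing the charts bounds the poles: [A] has degree at most [d2] in
    [y], and [B] at most [d2 + 2] ([coefs_at_y_infinity]); the degrees in [x]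
    are bounded in the same way by [d1] ([coefs_at_x_infinity]).  On the other
    side, if the two local coefficients have a nonconstant common divisor [g],
    then the curve [g = 0] is singular ([common_divisor_const]): over an
    algebraically closed field there are two primes [P] strictly below [Q]
    above any nonconstant [g] ([plane_curve_prime_chain]).

    - If [d2 < 0], then [A = 0], so that [s] is tangent to the ruling, and its
      single coefficient [B] has no zero in any chart.  Such a [B] generates the
      twist of the relative tangent sheaf, which forces the sheaf to be
      O(- delta, 2) ([negative_fibre_degree]).
    - If [delta = 0] and [d1 < 0], the same happens with the two rulings
      exchanged, and the sheaf is O(2, 0) ([negative_base_degree]).
    - If [delta > 0] and [d1 < - 1], then [s] vanishes along the negative
      section [y = 0] ([base_degree_ge_opp1]).  The degree bounds for [A] and
      [B] on this curve are negative, except when [d1 = - 2], in which case [A]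
      may be a constant [a] there.  But the change of fibre coordinate
      [t = x ^ delta * y] makes [delta * a] appear as a coefficient of a pole
      at [x = infinity], so that [a = 0] in characteristic zero.

    All comparisons between charts go through Laurent coefficients
    ([laurent]): the sections over a chart are the Laurent polynomials in [x]
    and [y] supported in a cone given by a linear change of exponents
    ([laurent_chart_eval]). *)

(** * Prime ideals above a plane curve *)

Lemma irreducible_divisor (R : idomainType) (p : {poly R}) :
  (1 < size p)%N -> exists2 q, irreducible_poly q & q %| p.
Proof.
have [n] := ubnP (size p); elim: n p => // n IHn p le_p_n p_gt1.
have [p_irr|/existsNP[q /not_implyP[q_neq1 /not_implyP[q_dvd_p q_neqp]]]] :=
  pselect (forall q : {poly R}, size q != 1%N -> q %| p -> q %= p).
  by exists p; [split | apply: dvdpp].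
have p_neq0 : p != 0 by rewrite -size_poly_gt0 (ltn_trans _ p_gt1).
have q_neq0 : q != 0.
  by apply: contraNneq p_neq0 => q0; rewrite q0 dvd0p in q_dvd_p.
have q_lt_p : (size q < size p)%N.
  rewrite ltn_neqAle dvdp_leq // andbT; apply/negP => /eqP eq_size.
  by apply: q_neqp; rewrite -dvdp_size_eqp // eq_size.
have [r r_irr r_dvd_q] : exists2 r, irreducible_poly r & r %| q.
  apply: IHn; first exact: leq_trans q_lt_p _.
  by rewrite ltn_neqAle eq_sym q_neq1 size_poly_gt0.
by exists r => //; apply: dvdp_trans r_dvd_q q_dvd_p.
Qed.

(** Divisibility and irreducibility in [{poly R}] are those of pseudo-division,
    that is, of polynomials over the fraction field of [R]; this is why
    irreducible elements are prime although [R] is any domain. *)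
Lemma irreducible_dvdpM (R : idomainType) (q u v : {poly R}) :
  irreducible_poly q -> q %| u * v -> (q %| u) || (q %| v).
Proof.
move=> [q_gt1 q_irr] q_uv; case: (boolP (q %| u)) => //= q_ndvd.
suff cop : coprimep q u by rewrite Gauss_dvdpr in q_uv.
rewrite coprimep_def; apply: contraNT q_ndvd => /q_irr/(_ (dvdp_gcdl q u)).
by move/eqp_dvdl <-; apply: dvdp_gcdr.
Qed.

Lemma kernel_is_prime (k : fieldType) (L : idomainType)
    (f : {rmorphism {poly {poly k}} -> L}) :
  is_prime_ideal (fun p : {poly {poly k}} => f p == 0).
Proof.
split; first split.
- by rewrite unfold_in rmorph0.
- by rewrite unfold_in rmorph1 oner_eq0.
- move=> a u v; rewrite !unfold_in => /eqP fu /eqP fv.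
  by rewrite rmorphD rmorphM fu fv mulr0 addr0.
- by move=> u v; rewrite !unfold_in rmorphM mulf_eq0.
Qed.

Section PlaneCurve.
Variable k : closedFieldType.
Local Notation B := {poly {poly k}}.

Definition specializeY (t : k) : {rmorphism B -> {poly k}} :=
  map_poly (horner_eval t).
Definition eval_at (z t : k) : {rmorphism B -> k} :=
  horner_eval z \o specializeY t.

Lemma specializeY_C t (c : {poly k}) : specializeY t c%:P = (c.[t])%:P.
Proof. by rewrite /specializeY /= map_polyC. Qed.

Lemma eval_atE z t (p : B) : eval_at z t p = (specializeY t p).[z].
Proof. by []. Qed.

(** When [g] involves ['X], the smaller prime consists of the multiples, over
    [k('Y)], of an irreducible factor [q] of [g].  Specializing ['Y] to a value
    [t] that is not a root of the leading coefficient of [q] keeps the degree of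
    [q], so that [q] has a zero [(z, t)]; all elements of the prime vanish
    there, because they are multiples of [q] up to a power of that leading
    coefficient.  When [g] does not involve ['X], it vanishes on a line
    ['Y = t]. *)
Lemma plane_curve_prime_chain (g : B) : (forall c : k, g != c%:P%:P) ->
  exists P Q : {pred B},
    [/\ is_prime_ideal P, is_prime_ideal Q, g \in P,
        {subset P <= Q} & ~ {subset Q <= P}].
Proof.
move=> g_nonconst; have [g_le1|g_gt1] := leqP (size g) 1.
  have def_g := size1_polyC g_le1.
  have /closed_rootP[t /rootP gt0] : size g`_0 != 1%N.
    apply: contraTneq isT => g0_1; move: (g_nonconst g`_0`_0).
    by rewrite -size1_polyC ?g0_1 // -def_g eqxx.
  exists (fun p : B => specializeY t p == 0),
    (fun p : B => eval_at 0 t p == 0).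
  split; try exact: kernel_is_prime.
  - by rewrite unfold_in def_g specializeY_C gt0.
  - by move=> p; rewrite !unfold_in /= => /eqP->; rewrite /horner_eval horner0.
  - move=> /(_ 'X); rewrite !unfold_in /= !map_polyX /horner_eval hornerX eqxx.
    by move/(_ isT); rewrite polyX_eq0.
have [q q_irr q_dvd_g] := irreducible_divisor g_gt1.
have [q_gt1 _] := q_irr.
have q_neq0 := irredp_neq0 q_irr.
have /closed_nonrootP[t lc_t] : lead_coef q != 0 by rewrite lead_coef_eq0.
have /closed_rootP[z /rootP qz0] : size (specializeY t q) != 1%N.
  by rewrite /specializeY /= size_map_poly_id0 ?gtn_eqF // horner_evalE.
exists (fun p : B => q %| p),
  (fun p : B => eval_at z t p == 0); split => //.
- split; first split; rewrite ?unfold_in ?dvdp0 //.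
  + apply/negP => /dvdp_leq; rewrite oner_eq0 size_poly1 leqNgt q_gt1.
    by move=> /(_ isT).
  + by move=> a u v; rewrite !unfold_in => qu qv; rewrite dvdp_add // dvdp_mull.
  + by move=> u v; rewrite !unfold_in; apply: irreducible_dvdpM.
- exact: kernel_is_prime.
- move=> p; rewrite !unfold_in dvdp_eq => /eqP def_p.
  have := congr1 (eval_at z t) def_p.
  rewrite -mul_polyC !rmorphM !eval_atE specializeY_C hornerC horner_exp qz0.
  rewrite mulr0 => /eqP; rewrite mulf_eq0 => /orP[|//].
  by rewrite expf_eq0 => /andP[_ lc0]; case/rootP: lc_t; apply/eqP.
(* ['Y - t] vanishes at [(z, t)], but has degree zero in ['X]. *)
- move=> /(_ ('X - t%:P)%:P); rewrite !unfold_in eval_atE specializeY_C hornerC.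
  rewrite !hornerE subrr eqxx => /(_ isT) /dvdp_leq.
  rewrite polyC_eq0 polyXsubC_eq0 size_polyC polyXsubC_eq0 /= leqNgt q_gt1.
  by move=> /(_ isT).
Qed.
End PlaneCurve.

(** * Laurent coefficients of the functions regular on a chart *)

HB.instance Definition _ (k : fieldType) :=
  GRing.RMorphism.copy (@const_fun k)
    (@tofrac {poly {poly k}} \o polyC \o polyC).

HB.instance Definition _ (k : fieldType) (delta : nat) (i : chart) :=
  GRing.RMorphism.copy (@chart_eval k delta i)
    (horner_eval (fibre_coord k delta i) \o horner_eval (base_coord k i)%:P
       \o map_poly (map_poly (@const_fun k))).

(** For an arbitrary field, because the tactic [field] would unfold the
    construction of fractions. *)
Lemma monomial_shift (F : fieldType) (u v f t : F) (N : nat) : u != 0 ->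
  (u * v) ^+ N.+1 * (t * u^-1 * f) = (u * v) ^+ N * (t * f) * v.
Proof. by move=> u0; rewrite exprS; field. Qed.

Section Laurent.
Variable k : fieldType.
Local Notation B := {poly {poly k}}.
Local Notation K := (fun_field k).
Local Notation x := (x_fun k).
Local Notation y := (y_fun k).

Lemma x_fun_neq0 : x != 0.
Proof. by rewrite tofrac_eq0 polyX_eq0. Qed.

Lemma y_fun_neq0 : y != 0.
Proof. by rewrite tofrac_eq0 polyC_eq0 polyX_eq0. Qed.

(** Integer exponents let the changes of charts act linearly on indices. *)
Definition coefz (p : B) (m n : int) : k :=
  match m, n with Posz a, Posz b => p`_a`_b | _, _ => 0 end.

Lemma coefz_lt0l p m n : m < 0 -> coefz p m n = 0.
Proof. by case: m. Qed.

Lemma coefz_lt0r p m n : n < 0 -> coefz p m n = 0.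
Proof. by case: m; case: n. Qed.

Lemma coefz0 m n : coefz 0 m n = 0.
Proof. by case: m n => [a|a] [b|b] //=; rewrite !coef0. Qed.

Lemma coefz_eq0 p : (forall m n, coefz p m n = 0) -> p = 0.
Proof.
move=> p0; apply/polyP => a; apply/polyP => b.
by rewrite !coef0; apply: (p0 a b).
Qed.

Lemma coefzD p q m n : coefz (p + q) m n = coefz p m n + coefz q m n.
Proof. by case: m n => [a|a] [b|b] /=; rewrite ?addr0 // !coefD. Qed.

Lemma coefzMC p c m n : coefz (p * c%:P%:P) m n = coefz p m n * c.
Proof. by case: m n => [a|a] [b|b] /=; rewrite ?mul0r // !coefMC. Qed.

Lemma coefz_const c m n :
  coefz c%:P%:P m n = if (m == 0) && (n == 0) then c else 0.
Proof.
by case: m n => [[|a]|a] [[|b]|b] //=; rewrite !coefC ?coef0.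
Qed.

Lemma coefzMX p m n : coefz (p * 'X) m n = coefz p (m - 1) n.
Proof.
case: m => [[|a]|a]; last by rewrite [RHS]coefz_lt0l //; lia.
  by rewrite [RHS]coefz_lt0l //; case: n => [b|b] //=; rewrite coefMX coef0.
have -> : Posz a.+1 - 1 = a by lia.
by case: n => //= b; rewrite coefMX.
Qed.

Lemma coefzMY p m n : coefz (p * 'Y) m n = coefz p m (n - 1).
Proof.
case: n => [[|b]|b]; last by rewrite !coefz_lt0r //; lia.
  by rewrite [RHS]coefz_lt0r //; case: m => [a|a] //=; rewrite coefMC coefMX.
have -> : Posz b.+1 - 1 = b by lia.
by case: m => //= a; rewrite coefMC coefMX.
Qed.

Lemma coefz_divY p : (forall m, coefz p m 0 = 0) -> exists q, p = q * 'Y.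
Proof.
move=> p0; exists (map_poly (drop_poly 1) p).
apply/polyP => a; apply/polyP => -[|b].
  by rewrite coefMC coefMX; apply: (p0 a).
rewrite coefMC coefMX coef_map_id0; last by rewrite raddf0.
by rewrite coef_drop_poly addn1.
Qed.

(** [f] is the Laurent polynomial in [x] and [y] with coefficients [c]; the
    power of [x * y] clears its denominators. *)
Definition laurent_at (N : nat) (f : K) (c : int -> int -> k) : Prop :=
  exists2 D : B, (x * y) ^+ N * f = tofrac D
    & forall m n, c m n = coefz D (m + N%:Z) (n + N%:Z).

Definition laurent (f : K) (c : int -> int -> k) : Prop :=
  exists N, laurent_at N f c.

(** Two Laurent polynomials can thus be given the same denominator. *)
Lemma laurent_at_grow N M f c : laurent_at N f c -> laurent_at (N + M) f c.
Proof.
elim: M => [|M IHM]; first by rewrite addn0.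
move/IHM => [D def_D def_c]; rewrite addnS; exists (D * 'X * 'Y).
  by rewrite !tofracM -def_D exprSr -!mulrA [f * _]mulrC -!mulrA.
by move=> m n; rewrite coefzMY coefzMX def_c; congr coefz; lia.
Qed.

Lemma laurent_ext c c' f : (forall m n, c m n = c' m n) ->
  laurent f c -> laurent f c'.
Proof. by move=> eqc [N [D ? def_c]]; exists N, D => // m n; rewrite -eqc. Qed.

Lemma laurent_unique f c c' m n : laurent f c -> laurent f c' -> c m n = c' m n.
Proof.
move=> [N /(@laurent_at_grow _) lc] [N' /(@laurent_at_grow _) lc'].
have [D def_D ->] := lc N'; have [D' def_D' ->] := lc' N.
rewrite addnC; congr (coefz _ _ _); apply/eqP; rewrite -tofrac_eq.
by rewrite -def_D -def_D' addnC.
Qed.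

Lemma laurent0 : laurent 0 (fun _ _ => 0).
Proof. by exists 0%N, 0 => [|m n]; rewrite ?mulr0 ?tofrac0 ?coefz0. Qed.

Lemma laurentD f g c c' : laurent f c -> laurent g c' ->
  laurent (f + g) (fun m n => c m n + c' m n).
Proof.
move=> [N /(@laurent_at_grow _) lc] [N' /(@laurent_at_grow _) lc'].
have [D def_D def_c] := lc N'; have [D' def_D' def_c'] := lc' N.
exists (N + N')%N, (D + D') => [|m n].
  by rewrite mulrDr def_D addnC def_D' rmorphD.
by rewrite coefzD def_c def_c' addnC.
Qed.

Lemma laurentZ a f c : laurent f c ->
  laurent (const_fun a * f) (fun m n => c m n * a).
Proof.
move=> [N [D def_D def_c]]; exists N, (D * a%:P%:P) => [|m n].
  by rewrite mulrCA def_D mulrC rmorphM.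
by rewrite coefzMC def_c.
Qed.

Lemma laurentMX f c z : laurent f c ->
  laurent (x ^ z * f) (fun m n => c (m - z) n).
Proof.
have x0 := x_fun_neq0.
move=> lc; elim/int_ind: z => [|z IHz|z IHz].
- by rewrite expr0z mul1r; apply: laurent_ext lc => m n; rewrite subr0.
- have [N [D def_D def_c]] := IHz; exists N, (D * 'X) => [|m n].
    by rewrite exprSz tofracM -def_D -mulrA mulrCA mulrC.
  rewrite coefzMX; have := def_c (m - 1) n; congr (_ = _);
    [congr c|congr coefz]; lia.
- have [N [D def_D def_c]] := IHz; exists N.+1, (D * 'Y) => [|m n].
    have -> : - (z.+1)%:Z = - z%:Z - 1 by lia.
    by rewrite expfzDr // exprN1 tofracM -def_D monomial_shift.
  rewrite coefzMY; have := def_c (m + 1) n; congr (_ = _);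
    [congr c|congr coefz]; lia.
Qed.

Lemma laurentMY f c z : laurent f c ->
  laurent (y ^ z * f) (fun m n => c m (n - z)).
Proof.
have y0 := y_fun_neq0.
move=> lc; elim/int_ind: z => [|z IHz|z IHz].
- by rewrite expr0z mul1r; apply: laurent_ext lc => m n; rewrite subr0.
- have [N [D def_D def_c]] := IHz; exists N, (D * 'Y) => [|m n].
    by rewrite exprSz tofracM -def_D -mulrA mulrCA mulrC.
  rewrite coefzMY; have := def_c m (n - 1); congr (_ = _);
    [congr c|congr coefz]; lia.
- have [N [D def_D def_c]] := IHz; exists N.+1, (D * 'X) => [|m n].
    have -> : - (z.+1)%:Z = - z%:Z - 1 by lia.
    by rewrite expfzDr // exprN1 tofracM -def_D [x * y]mulrC monomial_shift.
  rewrite coefzMX; have := def_c m (n + 1); congr (_ = _);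
    [congr c|congr coefz]; lia.
Qed.

Section Charts.
Variables (delta : nat) (i : chart).

Lemma chart_eval_const (c : k) : chart_eval delta i c%:P%:P = const_fun c.
Proof. by rewrite /chart_eval !map_polyC /= !map_polyC !hornerC. Qed.

Lemma chart_evalX : chart_eval delta i 'X = base_coord k i.
Proof. by rewrite /chart_eval map_polyX hornerX hornerC. Qed.

Lemma chart_evalY : chart_eval delta i 'Y = fibre_coord k delta i.
Proof. by rewrite /chart_eval map_polyC hornerC /= map_polyX hornerX. Qed.

(** The monomial [x ^ m * y ^ n] is the monomial with exponents [base_exp m n]
    and [fibre_exp n] in the coordinates of the chart. *)
Definition base_exp (m n : int) : int := if i.1 then delta%:Z * n - m else m.
Definition fibre_exp (n : int) : int := if i.2 then - n else n.

Lemma base_coordE : base_coord k i = x ^ (if i.1 then -1 else 1).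
Proof. by rewrite /base_coord; case: ifP. Qed.

Lemma fibre_coordE : fibre_coord k delta i =
  x ^ (delta%:Z * (if i.1 then (if i.2 then -1 else 1) else 0)) *
  y ^ (if i.2 then -1 else 1).
Proof.
rewrite /fibre_coord; case: ifP; case: ifP => _ _;
  rewrite ?mulr0 ?mulr1 ?mul1r //.
by rewrite mulrN1 -invr_expz invfM exprN1.
Qed.

Lemma laurent_mul_base f (c : int -> int -> k) :
  laurent f (fun m n => c (base_exp m n) (fibre_exp n)) ->
  laurent (f * base_coord k i) (fun m n => c (base_exp m n - 1) (fibre_exp n)).
Proof.
move=> /(laurentMX (if i.1 then -1 else 1)); rewrite base_coordE mulrC.
by apply: laurent_ext => m n; rewrite /base_exp; congr c; case: i.1; lia.
Qed.

Lemma laurent_mul_fibre f (c : int -> int -> k) :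
  laurent f (fun m n => c (base_exp m n) (fibre_exp n)) ->
  laurent (f * fibre_coord k delta i)
    (fun m n => c (base_exp m n) (fibre_exp n - 1)).
Proof.
move=> /(laurentMY (if i.2 then -1 else 1)).
move=> /(laurentMX (delta%:Z * (if i.1 then (if i.2 then -1 else 1) else 0))).
rewrite mulrA fibre_coordE mulrC; apply: laurent_ext => m n.
by rewrite /base_exp /fibre_exp; congr c; case: i.1; case: i.2; lia.
Qed.

Lemma laurent_chart_eval p :
  laurent (chart_eval delta i p)
    (fun m n => coefz p (base_exp m n) (fibre_exp n)).
Proof.
elim/poly_ind: p => [|p c IHp].
  rewrite rmorph0; apply: laurent_ext laurent0 => m n.
  by rewrite coefz0.
rewrite rmorphD rmorphM /= chart_evalX.
have := laurent_mul_base IHp.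
suff Lc : laurent (chart_eval delta i c%:P)
            (fun m n => coefz c%:P (base_exp m n) (fibre_exp n)).
  move=> /laurentD/(_ Lc); apply: laurent_ext => m n.
  by rewrite coefzD coefzMX.
elim/poly_ind: c {p IHp} => [|c d IHc].
  rewrite polyC0 rmorph0; apply: laurent_ext laurent0 => m n.
  by rewrite coefz0.
have Ld : laurent (chart_eval delta i d%:P%:P)
       (fun m n => coefz d%:P%:P (base_exp m n) (fibre_exp n)).
  rewrite chart_eval_const; exists 0%N, d%:P%:P; first by rewrite mul1r.
  move=> m n; rewrite !coefz_const /base_exp /fibre_exp !addr0.
  by congr (if _ then _ else _); case: i.1; case: i.2; lia.
rewrite polyCD rmorphD polyCM rmorphM /= chart_evalY.
have := laurentD (laurent_mul_fibre IHc) Ld.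
by apply: laurent_ext => m n; rewrite coefzD coefzMY.
Qed.

(** The change of exponents is invertible over the integers, so that the
    coefficients of [p] can be read off the Laurent coefficients. *)
Lemma chart_eval_inj : injective (@chart_eval k delta i).
Proof.
apply: raddf_inj => p p_eval0; apply: coefz_eq0 => a b.
have := laurent_chart_eval p; rewrite p_eval0.
pose n := fibre_exp b; pose m := base_exp a n.
move=> /(laurent_unique m n)/(_ laurent0) <-.
by congr coefz; rewrite /m /n /base_exp /fibre_exp; case: i.1; case: i.2; lia.
Qed.
End Charts.
End Laurent.

(** * Derivations of the function field *)

Lemma frac_numden (R : idomainType) (f : {fraction R}) :
  exists p q : R, q != 0 /\ f * tofrac q = tofrac p.
Proof.
elim/quotW: f => r; have q_neq0 := denom_ratioP r.
exists (frac r).1, (frac r).2; split=> //.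
rewrite /FracField.tofrac; unlock FracField.tofrac; rewrite !piE.
apply/eqmodP; rewrite /= FracField.equivfE /FracField.mulf.
by rewrite !numden_Ratio ?mulr1 ?oner_eq0 // mulrC.
Qed.

Section Derivations.
Variables (k : fieldType) (v : fun_field k -> fun_field k).
Hypothesis v_der : is_derivation v.

Lemma derivation0 : v 0 = 0.
Proof. by case: v_der => _ _ /(_ 0); rewrite rmorph0. Qed.

Lemma derivation1 : v 1 = 0.
Proof. by case: v_der => _ _ /(_ 1); rewrite rmorph1. Qed.

Lemma derivation_eq0 : v (x_fun k) = 0 -> v (y_fun k) = 0 -> forall f, v f = 0.
Proof.
case: v_der => vD vM vC vx vy f.
have v_poly p : v (tofrac p) = 0.
  elim/poly_ind: p => [|p c IHp]; first by rewrite tofrac0 derivation0.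
  rewrite tofracD tofracM vD vM vx IHp mul0r mulr0 !add0r.
  elim/poly_ind: c => [|c d IHc]; first by rewrite tofrac0 derivation0.
  rewrite polyCD polyCM tofracD tofracM vD vM vy IHc mul0r mulr0 !add0r.
  exact: vC.
have [p [q [q0 def_p]]] := frac_numden f.
have := v_poly p; rewrite -def_p vM v_poly mulr0 addr0 => /eqP.
by rewrite mulf_eq0 tofrac_eq0 (negbTE q0) orbF => /eqP.
Qed.

Lemma derivationV f : f != 0 -> v f^-1 = - f ^ (-2) * v f.
Proof.
case: v_der => _ vM _ f0; apply: (mulfI f0).
have := derivation1; rewrite -(mulfV f0) vM addrC => /eqP.
rewrite addr_eq0 => /eqP ->.
by rewrite -exprnN expr2 invfM mulrA mulrN mulrA divff // mul1r mulNr mulrC.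
Qed.

Lemma derivationX f n : v (f ^+ n) = f ^+ n.-1 * v f *+ n.
Proof.
case: v_der => _ vM _.
elim: n => [|n IHn]; first by rewrite expr0 derivation1 mulr0n.
rewrite exprS vM IHn mulrS [v f * _]mulrC; congr (_ + _).
by case: n {IHn} => [|n]; rewrite ?mulr0n ?mulr0 // mulrnAr mulrA -exprS.
Qed.
End Derivations.

(** * Foliations with isolated singularities *)

Section Foliations.
Variables (k : closedFieldType) (delta : nat) (d1 d2 : int).
Local Notation B := {poly {poly k}}.
Local Notation K := (fun_field k).
Local Notation x := (x_fun k).
Local Notation y := (y_fun k).
Local Notation L := (O_sheaf k delta (- d1) (- d2)).
Local Notation eval := (@chart_eval k delta).

(** [P] and [Q] are the coefficients of the local vector field, written as
    polynomials in the coordinates of the chart. *)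
Definition local_coefs (s : K -> K) (i : chart) (P Q : B) : Prop :=
  eval i P = L i * s (base_coord k i) /\
  eval i Q = L i * s (fibre_coord k delta i).

Lemma O_sheaf_neq0 i : L i != 0.
Proof.
rewrite /O_sheaf; apply: mulf_neq0.
  case: i.1; last exact: oner_neq0.
  by rewrite base_coordE !expfz_neq0 ?x_fun_neq0.
case: i.2; last exact: oner_neq0.
by rewrite fibre_coordE expfz_neq0 ?mulf_neq0 ?expfz_neq0
  ?x_fun_neq0 ?y_fun_neq0.
Qed.

(** The local vector field [L i * s] preserves the chart ring, which contains
    the two coordinates. *)
Lemma twisted_section_local_coefs s :
  H0_twisted_tangent delta (dual_sheaf L) s ->
  is_derivation s /\ forall i, exists P Q, local_coefs s i P Q.
Proof.
move=> sec; split.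
  have [v [[vD vM vC] _] <-] := sec (false, false).
  split=> [f g|f g|c]; rewrite ?vD ?vM ?vC ?mulr0 ?mulrDr //.
  by rewrite mulrA; congr (_ + _); apply: mulrCA.
move=> i; have [v [_ v_ring] <-] := sec i.
have [|P _ def_P] := v_ring (base_coord k i).
  by exists 'X => //; apply: chart_evalX.
have [|Q _ def_Q] := v_ring (fibre_coord k delta i).
  by exists 'Y => //; apply: chart_evalY.
exists P, Q.
by rewrite /local_coefs def_P def_Q /dual_sheaf !mulVKf ?O_sheaf_neq0.
Qed.

Variable s : K -> K.
Hypothesis s_section : H0_twisted_tangent delta (dual_sheaf L) s.
Hypothesis s_neq0 : s <> (fun=> 0).
Hypothesis s_isolated : forall i, dim_le0 (singular_ideal delta L s i).

(** Otherwise both primes given by [plane_curve_prime_chain] contain the ideal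
    of the singular scheme, whose dimension is then positive. *)
Lemma common_divisor_const i P Q u v g :
  local_coefs s i P Q -> P = u * g -> Q = v * g -> exists c, g = c%:P%:P.
Proof.
move=> [def_P def_Q] Pg Qg; apply: contrapT => g_nonconst.
have [|p [q [p_prime q_prime gp p_q q_p]]] := @plane_curve_prime_chain k g.
  by move=> c; apply/eqP => gc; apply: g_nonconst; exists c.
apply: q_p; apply: (s_isolated (i := i) p_prime q_prime _ p_q) => f [a [b]].
rewrite -def_P -def_Q -!rmorphM -rmorphD => /(@chart_eval_inj k delta i) ->.
have [[p0 _ pD] _] := p_prime.
rewrite Pg Qg -[X in X \in _]addr0 !mulrA -mulrDl; exact: pD.
Qed.

Let s_der : is_derivation s := (twisted_section_local_coefs s_section).1.
Let s_coefs := (twisted_section_local_coefs s_section).2.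

Let sx_sy_neq0 : s x = 0 -> s y = 0 -> False.
Proof.
by move=> sx sy; apply: s_neq0; apply/funext; apply: derivation_eq0.
Qed.

Lemma affine_coefs : exists P Q, [/\ local_coefs s (false, false) P Q,
  laurent (s x) (coefz P) & laurent (s y) (coefz Q)].
Proof.
have [P [Q PQ]] := s_coefs (false, false); exists P, Q; split=> //.
  have := laurent_chart_eval delta (false, false) P.
  by rewrite PQ.1 /O_sheaf /= !mul1r.
have := laurent_chart_eval delta (false, false) Q.
by rewrite PQ.2 /O_sheaf /= !mul1r.
Qed.

(** With [w = y^-1], one has [s w = - y ^ (-2) * s y], which is why the bound
    on the degree of [s y] in [y] exceeds by 2 that on the degree of [s x]. *)
Lemma coefs_at_y_infinity : exists P Q, [/\ local_coefs s (false, true) P Q,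
  laurent (y ^ (- d2) * s x) (fun m n => coefz P m (- n))
  & laurent (- (y ^ (- d2 - 2) * s y)) (fun m n => coefz Q m (- n))].
Proof.
have y0 := y_fun_neq0 k.
have [P [Q PQ]] := s_coefs (false, true); exists P, Q; split=> //.
  have := laurent_chart_eval delta (false, true) P.
  by rewrite PQ.1 /O_sheaf /= mul1r opprK exprz_inv.
have := laurent_chart_eval delta (false, true) Q.
rewrite PQ.2 /O_sheaf /= mul1r opprK exprz_inv /fibre_coord /=.
by rewrite derivationV // expfzDr // mulNr mulrN mulrA.
Qed.

(** The second coefficient is [s t] for [t = x ^ delta * y], expanded by the
    Leibniz rule. *)
Lemma coefs_at_x_infinity : exists P Q, [/\ local_coefs s (true, false) P Q,
  laurent (- (x ^ (- d1 - 2) * s x)) (fun m n => coefz P (delta%:Z * n - m) n)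
  & laurent (x ^ (- d1) * (x ^+ delta.-1 * s x *+ delta * y + x ^+ delta * s y))
      (fun m n => coefz Q (delta%:Z * n - m) n)].
Proof.
have x0 := x_fun_neq0 k.
have [P [Q PQ]] := s_coefs (true, false); exists P, Q; split=> //.
  have := laurent_chart_eval delta (true, false) P.
  rewrite PQ.1 /O_sheaf /= mulr1 opprK exprz_inv /base_coord /=.
  by rewrite derivationV // expfzDr // mulNr mulrN mulrA.
have := laurent_chart_eval delta (true, false) Q.
rewrite PQ.2 /O_sheaf /= mulr1 opprK exprz_inv /fibre_coord /base_coord /=.
by case: s_der => _ -> _; rewrite derivationX.
Qed.

Lemma vertical_const i P Q : local_coefs s i P Q -> P = 0 ->
  exists c, Q = c%:P%:P.
Proof.
move=> PQ P0; apply: (common_divisor_const (u := 0) (v := 1) PQ);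
  by rewrite ?mul0r ?mul1r.
Qed.

Lemma horizontal_const i P Q : local_coefs s i P Q -> Q = 0 ->
  exists c, P = c%:P%:P.
Proof.
move=> PQ Q0; apply: (common_divisor_const (u := 1) (v := 0) PQ);
  by rewrite ?mul0r ?mul1r.
Qed.

(** The degree bound gives [s x = 0], so that [s y] is a nonzero constant; at
    each of the two infinities it becomes a monomial in the local coordinates,
    which has to be a constant too, and the exponent of this monomial is
    [d2 + 2] on one side, [d1 - delta] on the other. *)
Lemma negative_fibre_degree : d2 < 0 -> d2 = - 2 /\ d1 = delta.
Proof.
move=> d2_lt0.
have [P [Q [PQ LP LQ]]] := affine_coefs.
have [P' [Q' [PQ' LP' LQ']]] := coefs_at_y_infinity.
have [P'' [Q'' [PQ'' LP'' LQ'']]] := coefs_at_x_infinity.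
have P0 : P = 0.
  apply: coefz_eq0 => m n.
  have [n_lt0|n_ge0] := ltrP n 0; first exact: coefz_lt0r.
  have := laurent_unique m (n - d2) (laurentMY (- d2) LP) LP'.
  by rewrite opprK subrK => ->; rewrite coefz_lt0r //; lia.
have sx0 : s x = 0 by move: PQ.1; rewrite P0 rmorph0 /O_sheaf /= !mul1r.
have [c Qc] := vertical_const PQ P0.
have c_neq0 : c != 0.
  apply/eqP => c0; apply: sx_sy_neq0 => //.
  by move: PQ.2; rewrite Qc c0 !polyC0 rmorph0 /O_sheaf /= !mul1r.
split.
  have P'0 : P' = 0.
    apply: (@chart_eval_inj k delta (false, true)).
    by rewrite PQ'.1 rmorph0 /base_coord /= sx0 mulr0.
  have [c' Q'c] := vertical_const PQ' P'0.
  have := laurent_unique 0 (- d2 - 2)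
    (laurentZ (- 1) (laurentMY (- d2 - 2) LQ)).
  rewrite rmorphN1 mulN1r => /(_ _ LQ').
  rewrite Qc Q'c !coefz_const subrr /=.
  case: eqP => [|_ /eqP]; first by lia.
  by rewrite mulrN1 oppr_eq0 (negbTE c_neq0).
have P''0 : P'' = 0.
  apply: (@chart_eval_inj k delta (true, false)).
  rewrite PQ''.1 rmorph0 /base_coord /= derivationV ?x_fun_neq0 //.
  by rewrite sx0 !mulr0.
have [c' Q''c] := vertical_const PQ'' P''0.
have := laurent_unique (delta%:Z - d1) 0
  (laurentMX (- d1) (laurentMX delta LQ)).
move: LQ''; rewrite sx0 mulr0 mul0rn mul0r add0r => LQ'' /(_ _ LQ'').
rewrite Qc Q''c !coefz_const mulr0 !eqxx !andbT.
rewrite (_ : _ - _ - _ = 0) ?eqxx; last by lia.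
case: eqP => [|_ /eqP]; first by lia.
by rewrite (negbTE c_neq0).
Qed.

(** Both projections of P^1 x P^1 play the same role: here [s y] vanishes and
    [s x] is a constant, whose monomials at the infinities have exponents
    [d1 + 2] and [d2]. *)
Lemma negative_base_degree : delta = 0%N -> d1 < 0 -> d1 = - 2 /\ d2 = 0.
Proof.
move=> delta0 d1_lt0.
have [P [Q [PQ LP LQ]]] := affine_coefs.
have [P' [Q' [PQ' LP' LQ']]] := coefs_at_y_infinity.
have [P'' [Q'' [PQ'' LP'' LQ'']]] := coefs_at_x_infinity.
rewrite delta0 mulr0n mul0r add0r mul1r in LQ''.
rewrite delta0 in LP''.
have Q0 : Q = 0.
  apply: coefz_eq0 => m n.
  have [m_lt0|m_ge0] := ltrP m 0; first exact: coefz_lt0l.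
  have := laurent_unique (m - d1) n (laurentMX (- d1) LQ) LQ''.
  by rewrite opprK subrK => ->; rewrite coefz_lt0l //; lia.
have sy0 : s y = 0 by move: PQ.2; rewrite Q0 rmorph0 /O_sheaf /= !mul1r.
have [c Pc] := horizontal_const PQ Q0.
have c_neq0 : c != 0.
  apply/eqP => c0; apply: sx_sy_neq0 => //.
  by move: PQ.1; rewrite Pc c0 !polyC0 rmorph0 /O_sheaf /= !mul1r.
split.
  have Q''0 : Q'' = 0.
    apply: (@chart_eval_inj k delta (true, false)).
    by rewrite PQ''.2 rmorph0 /fibre_coord /= delta0 mul1r sy0 mulr0.
  have [c' P''c] := horizontal_const PQ'' Q''0.
  have := laurent_unique (- d1 - 2) 0
    (laurentZ (- 1) (laurentMX (- d1 - 2) LP)).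
  rewrite rmorphN1 mulN1r => /(_ _ LP'').
  rewrite Pc P''c !coefz_const subrr /=.
  case: eqP => [|_ /eqP]; first by lia.
  by rewrite mulrN1 oppr_eq0 (negbTE c_neq0).
have Q'0 : Q' = 0.
  apply: (@chart_eval_inj k delta (false, true)).
  rewrite PQ'.2 rmorph0 /fibre_coord /= derivationV ?y_fun_neq0 //.
  by rewrite sy0 !mulr0.
have [c' P'c] := horizontal_const PQ' Q'0.
have := laurent_unique 0 (- d2) (laurentMY (- d2) LP) LP'.
rewrite Pc P'c !coefz_const subrr opprK !eqxx /=.
case: eqP => [|_ /eqP]; first by lia.
by rewrite (negbTE c_neq0).
Qed.

(** If [d1 < - 1], then ['Y] divides both coefficients in the first chart, and
    the section [y = 0] consists of singular points. *)
Lemma base_degree_ge_opp1 : delta%:R != 0 :> k -> -1 <= d1.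
Proof.
move=> delta_neq0; rewrite leNgt; apply/negP => d1_lt.
have delta_gt0 : (0 < delta)%N by case: delta delta_neq0; rewrite ?eqxx.
have [P [Q [PQ LP LQ]]] := affine_coefs.
have [P' [Q' [PQ' LP' LQ']]] := coefs_at_x_infinity.
have P_coef m : coefz P m 0 = - coefz P' (d1 + 2 - m) 0.
  have := laurent_unique (m - d1 - 2) 0
    (laurentZ (- 1) (laurentMX (- d1 - 2) LP)).
  rewrite rmorphN1 mulN1r => /(_ _ LP').
  rewrite mulrN1 (_ : _ - _ - _ - (_ - _) = m); last by lia.
  by move/eqP; rewrite eqr_oppLR => /eqP ->; congr (- coefz _ _ _); lia.
have Q_coef m n : coefz P (m + d1 - delta%:Z + 1) (n - 1) * delta%:R +
    coefz Q (m + d1 - delta%:Z) n = coefz Q' (delta%:Z * n - m) n.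
  have := laurentMX (- d1) (laurentD
    (laurentZ delta%:R (laurentMY 1 (laurentMX delta.-1 LP)))
    (laurentMX delta LQ)).
  rewrite rmorph_nat mulr_natl expr1z [y * _]mulrC -mulrnAl -exprnP.
  move=> /(laurent_unique m n)/(_ LQ') <-.
  by congr (coefz _ _ _ * _ + coefz _ _ _); lia.
have P0 m : coefz P m 0 = 0.
  have [m_lt0|m_ge0] := ltrP m 0; first exact: coefz_lt0l.
  have [m_gt|m_le] := ltrP (d1 + 2) m.
    by rewrite P_coef coefz_lt0l ?oppr0 //; lia.
  have {m_ge0 m_le} -> : m = 0 by lia.
  (* Now [d1 = - 2], and these exponents are those of [u^-1 * t] for the local
     coordinates [u = x^-1] and [t = x ^ delta * y]: a pole, to which only the
     term of [s x] contributes. *)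
  have := Q_coef (delta%:Z - 1 - d1) 1.
  rewrite [coefz Q _ _]coefz_lt0l; last by lia.
  rewrite [RHS]coefz_lt0l; last by lia.
  rewrite subrr (_ : _ + _ - _ + _ = 0); last by lia.
  by rewrite addr0 => /eqP; rewrite mulf_eq0 (negbTE delta_neq0) orbF => /eqP.
have Q0 m : coefz Q m 0 = 0.
  have [m_lt0|m_ge0] := ltrP m 0; first exact: coefz_lt0l.
  have := Q_coef (m - d1 + delta%:Z) 0.
  rewrite [coefz P _ _]coefz_lt0r // [RHS]coefz_lt0l; last by lia.
  by rewrite mul0r add0r => <-; congr coefz; lia.
have [u Pu] := coefz_divY P0; have [v Qv] := coefz_divY Q0.
have [c] := common_divisor_const PQ Pu Qv.
move=> /polyC_inj/(congr1 (size : {poly k} -> nat))/eqP.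
by rewrite size_polyX size_polyC; case: (c != 0).
Qed.
End Foliations.

Theorem proposition3p6 (R : realType) (delta : nat) (d1 d2 : int) :
  let L := O_sheaf R[i] delta (- d1) (- d2) in
  (exists F, Fol delta L F /\ isolated_singularities delta L F) ->
  (delta = 0%N ->
     inv_sheaf_iso delta L (O_sheaf R[i] delta (- delta%:Z) 2) \/
     inv_sheaf_iso delta L (O_sheaf R[i] delta 2 0) \/
     (0 <= d1 /\ 0 <= d2)) /\
  ((1 <= delta)%N ->
     inv_sheaf_iso delta L (O_sheaf R[i] delta (- delta%:Z) 2) \/
     (-1 <= d1 /\ 0 <= d2)).
Proof.
move=> L [F [[s [s_sec s_neq0 ->]] F_iso]].
have s_iso i : dim_le0 (singular_ideal delta L s i).
  apply: F_iso; exists 1; first exact: oner_neq0.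
  by apply/funext => f; rewrite rmorph1 mul1r.
have iso_refl M : inv_sheaf_iso delta M M.
  by exists 1 => [|i z]; rewrite ?oner_neq0 ?mul1r.
have d2_neg :
    d2 < 0 -> inv_sheaf_iso delta L (O_sheaf R[i] delta (- delta%:Z) 2).
  move=> /(negative_fibre_degree s_sec s_neq0 s_iso)[d2E d1E].
  by rewrite /L d2E d1E.
split=> [delta0|delta_gt0]; have [/d2_neg|d2_ge0] := ltrP d2 0; try by left.
- have [d1_lt0|d1_ge0] := ltrP d1 0; last by right; right.
  have [d1E d2E] := negative_base_degree s_sec s_neq0 s_iso delta0 d1_lt0.
  by right; left; rewrite /L d2E d1E.
- right; split=> //; apply: (base_degree_ge_opp1 s_sec s_iso).
  by rewrite pnatr_eq0 -lt0n.
Qed.
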